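(* For polarizations of rank $k$, $1\le k\le 20$: (1) the radical of $\mathrm{Lie}(\mathsf{G}_k)$ has dimension $21-k$; (2) (computation of the Levi factor) $\mathrm{Lie}(\mathsf{G}_k)/\mathrm{rad}(\mathrm{Lie}(\mathsf{G}_k))\cong\mathfrak{so}_{20-k}(\mathbb{C})$; (3) $\mathsf{AMSY}_k$ is the Lie subalgebra of $\mathfrak{gl}_{22-k}(\mathbb{C})$ generated by $\mathrm{Lie}(\mathsf{G}_k)$ and $\{g^T : g\in\mathrm{nilrad}(\mathrm{Lie}(\mathsf{G}_k))\}$ (the transpose of the nilradical); (4) $\mathsf{AMSY}_k\cong\mathfrak{so}_{22-k}(\mathbb{C})$.
   Context: For complex K3 surfaces $X$ with a lattice polarization $\iota$ by a lattice $L$ of rank $k$, the quotient $H^2_{dR}(X/\mathbb{C})/\iota(L)$ has dimension $22-k$. Let $\Psi=\begin{bmatrix}0&0&1\\0&\Psi'&0\\1&0&0\end{bmatrix}\in\mathrm{Mat}_{22-k}(\mathbb{C})$, where $\Psi'$ is a non-singular symmetric $(20-k)\times(20-k)$ complex matrix. $\mathsf{G}_k$ is the complex algebraic group of all $g\in\mathrm{Mat}_{22-k}(\mathbb{C})$ such that $g^T\Psi g=\Psi$ and $g^T$ respects the Hodge filtration, i.e. $g^T$ is block lower triangular with diagonal blocks of sizes $1,20-k,1$. $\mathsf{AMSY}_k$ (also written $\mathfrak{G}_k$) denotes the AMSY-Lie algebra for polarizations of rank $k$; the paper also takes the description in item (3) as its definition. Over $\mathbb{C}$, the paper regards $\mathsf{G}_k$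 and $\mathsf{AMSY}_k$ as depending only on the rank $k$ of the polarization, and not on the choice of $\Psi'$.
   Formalization: Items (1) and (2) exclude k=18, where Lie(G_k) is solvable of dimension 4 and both fail; item (4) assumes Ψ'²=1, since for k≤19 the algebra generated in (3) is larger than so_{22-k} otherwise (e.g. sl_3 for k=19, Ψ'=(2)). *)

(* Defs.v *)
From HB Require Import structures.
From mathcomp Require Import all_boot all_order all_algebra.
From mathcomp Require Import generic_quotient ring_quotient qpoly.
From mathcomp Require Import boolp classical_sets ring zify.

Set Implicit Arguments.
Unset Strict Implicit.
Unset Printing Implicit Defensive.
Import Order.TTheory GRing.Theory Num.Theory.
Local Open Scope ring_scope.

HB.mixin Record Lmodule_isLie (K : fieldType) V of GRing.Lmodule K V := {
  bracket : V -> V -> V;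
  bracketPl : forall y, linear (bracket^~ y);
  bracketPr : forall x, linear (bracket x);
  bracketxx : forall x, bracket x x = 0;
  bracket_jacobi : forall x y z,
    bracket x (bracket y z) + bracket y (bracket z x)
      + bracket z (bracket x y) = 0
}.

#[short(type="lieAlgebraType")]
HB.structure Definition LieAlgebra (K : fieldType) :=
  {V of Lmodule_isLie K V & GRing.Lmodule K V}.

#[short(type="finLieAlgebraType")]
HB.structure Definition FinLieAlgebra (K : fieldType) :=
  {V of LieAlgebra K V & Vector K V}.

Section BracketTheory.
Variables (K : fieldType) (L : lieAlgebraType K).
Implicit Types x y z : L.

Lemma bracketDl x y z : bracket (x + y) z = bracket x z + bracket y z.
Proof. by rewrite -[x]scale1r (@bracketPl _ L) !scale1r. Qed.
Lemma bracketDr x y z : bracket x (y + z) = bracket x y + bracket x z.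
Proof. by rewrite -[y]scale1r bracketPr !scale1r. Qed.
Lemma bracket0x x : bracket 0 x = 0.
Proof. by apply: (addrI (bracket 0 x)); rewrite -bracketDl !addr0. Qed.
Lemma bracketx0 x : bracket x 0 = 0.
Proof. by apply: (addrI (bracket x 0)); rewrite -bracketDr !addr0. Qed.
Lemma bracketZl a x y : bracket (a *: x) y = a *: bracket x y.
Proof. by have := @bracketPl _ L y a x 0; rewrite bracket0x !addr0. Qed.
Lemma bracketZr a x y : bracket x (a *: y) = a *: bracket x y.
Proof. by have := @bracketPr _ L x a y 0; rewrite bracketx0 !addr0. Qed.
Lemma bracketC x y : bracket x y = - bracket y x.
Proof.
have := bracketxx (x + y); rewrite bracketDl !bracketDr !bracketxx add0r addr0.
by move/eqP; rewrite addr_eq0 => /eqP.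
Qed.
End BracketTheory.

Definition lie_isomorphic (K : fieldType) (L1 L2 : lieAlgebraType K) : Prop :=
  exists f : {linear L1 -> L2},
    bijective f /\ forall x y, f (bracket x y) = bracket (f x) (f y).

Section MatrixLie.
Variables (K : fieldType) (n : nat).
Implicit Types A B C : 'M[K]_n.

Definition mx_bracket A B := A *m B - B *m A.

Fact mx_bracketPl B : linear (mx_bracket^~ B).
Proof.
by move=> a A C; rewrite /mx_bracket mulmxDl mulmxDr -scalemxAl -scalemxAr
  scalerBr opprD addrACA.
Qed.
Fact mx_bracketPr A : linear (mx_bracket A).
Proof.
by move=> a B C; rewrite /mx_bracket mulmxDl mulmxDr -scalemxAl -scalemxAr
  scalerBr opprD addrACA.
Qed.
Fact mx_bracketxx A : mx_bracket A A = 0.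
Proof. exact: subrr. Qed.
Fact mx_bracket_jacobi A B C :
  mx_bracket A (mx_bracket B C) + mx_bracket B (mx_bracket C A)
    + mx_bracket C (mx_bracket A B) = 0.
Proof.
rewrite /mx_bracket !mulmxBr !mulmxBl !mulmxA !opprB.
set a := A *m B *m C; set b := A *m C *m B; set c := B *m C *m A.
set d := B *m A *m C; set e := C *m A *m B; set f := C *m B *m A.
by apply/matrixP=> i j; rewrite !mxE; ring.
Qed.

HB.instance Definition _ := Lmodule_isLie.Build K 'M[K]_n
  mx_bracketPl mx_bracketPr mx_bracketxx mx_bracket_jacobi.
End MatrixLie.

Section LieSubspaces.
Variables (K : fieldType) (L : finLieAlgebraType K).
Implicit Types (U V W I J : {vspace L}).

Definition lie_prod U V : {vspace L} :=
  <<[seq bracket u v | u <- vbasis U, v <- vbasis V]>>%VS.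

Lemma mem_lie_prod U V u v : u \in U -> v \in V -> bracket u v \in lie_prod U V.
Proof.
move=> uU vV; rewrite (coord_vbasis uU) (coord_vbasis vV).
have sumD (I : finType) (F : I -> L) y :
  bracket (\sum_i F i) y = \sum_i bracket (F i) y.
  by apply: (big_morph (bracket^~ y)) => [a b|]; rewrite ?bracketDl ?bracket0x.
have sumE (I : finType) (F : I -> L) y :
  bracket y (\sum_i F i) = \sum_i bracket y (F i).
  by apply: (big_morph (bracket y)) => [a b|]; rewrite ?bracketDr ?bracketx0.
rewrite sumD memv_suml // => i _; rewrite sumE memv_suml // => j _.
rewrite bracketZl bracketZr !memvZ // memv_span //.
by apply: allpairs_f; rewrite -tnth_nth mem_tnth.
Qed.

Lemma lie_prod_subP U V W :
  reflect (forall u v, u \in U -> v \in V -> bracket u v \in W)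
          (lie_prod U V <= W)%VS.
Proof.
apply: (iffP idP) => [UVW u v uU vV | UVW].
  exact: subvP UVW _ (mem_lie_prod uU vV).
apply/span_subvP => w /allpairsP[[u v] /= [uU vV ->]].
by apply: UVW; rewrite vbasis_mem.
Qed.

Definition is_subalgebra U : bool := (lie_prod U U <= U)%VS.
Definition is_ideal I : bool := (lie_prod fullv I <= I)%VS.

Definition derived_series n U : {vspace L} := iter n (fun W => lie_prod W W) U.
Definition lower_central_series n U : {vspace L} := iter n (lie_prod U) U.
Definition solvable U : Prop := exists n, derived_series n U = 0%VS.
Definition nilpotent U : Prop := exists n, lower_central_series n U = 0%VS.

Definition is_radical I : Prop :=
  [/\ is_ideal I, solvable I
    & forall J, is_ideal J -> solvable J -> (J <= I)%VS].
Definition is_nilradical I : Prop :=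
  [/\ is_ideal I, nilpotent I
    & forall J, is_ideal J -> nilpotent J -> (J <= I)%VS].

Lemma lie_prodS U U' V V' :
  (U <= U')%VS -> (V <= V')%VS -> (lie_prod U V <= lie_prod U' V')%VS.
Proof.
move=> sU sV; apply/lie_prod_subP => u v uU vV.
by rewrite mem_lie_prod ?(subvP sU) ?(subvP sV).
Qed.

Lemma idealP I : reflect (forall x y, y \in I -> bracket x y \in I) (is_ideal I).
Proof.
apply: (iffP (lie_prod_subP _ _ _)) => [h x y yI | h x y _]; last exact: h.
by apply: h; rewrite ?memvf.
Qed.

Lemma ideal_memr I x y : is_ideal I -> y \in I -> bracket x y \in I.
Proof. by move/idealP; apply. Qed.
Lemma ideal_meml I x y : is_ideal I -> x \in I -> bracket x y \in I.
Proof. by move=> idI xI; rewrite bracketC memvN ideal_memr. Qed.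

Lemma ideal0 : is_ideal 0%VS.
Proof. by apply/idealP => x y; rewrite !memv0 => /eqP->; rewrite bracketx0. Qed.

Lemma ideal_addv I J : is_ideal I -> is_ideal J -> is_ideal (I + J)%VS.
Proof.
move=> idI idJ; apply/idealP => x y /memv_addP[a aI [b bJ ->]].
by rewrite bracketDr memv_add ?ideal_memr.
Qed.

Lemma ideal_lie_prod I J : is_ideal I -> is_ideal J -> is_ideal (lie_prod I J).
Proof.
move=> idI idJ; apply/idealP => x.
pose f := linfun (bracket x).
have fE y : f y = bracket x y.
  pose g : {linear L -> L} := HB.pack (bracket x)
    (GRing.isLinear.Build K L L _ (bracket x) (@bracketPr _ _ x)).
  exact: (lfunE g).
suff h : (lie_prod I J <= f @^-1: lie_prod I J)%VS.
  by move=> y /(subvP h); rewrite -memv_preim fE.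
apply/lie_prod_subP => u v uI vJ; rewrite -memv_preim fE.
have /eqP := bracket_jacobi x u v; rewrite -addrA addr_eq0 => /eqP ->.
rewrite memvN memvD //.
  by apply: mem_lie_prod => //; apply: ideal_meml.
by rewrite bracketC memvN mem_lie_prod //; apply: ideal_memr.
Qed.

Lemma solvable0 : solvable 0%VS. Proof. by exists 0%N. Qed.
Lemma nilpotent0 : nilpotent 0%VS. Proof. by exists 0%N. Qed.

Lemma derived_seriesS n U V :
  (U <= V)%VS -> (derived_series n U <= derived_series n V)%VS.
Proof. by move=> UV; elim: n => //= n IH; apply: lie_prodS. Qed.

Lemma solvable_addv I J : is_ideal J -> solvable I -> solvable J ->
  solvable (I + J)%VS.
Proof.
move=> idJ [n nI] [m mJ].
have h k : (derived_series k (I + J) <= derived_series k I + J)%VS.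
  elim: k => //= k IH; apply: subv_trans (lie_prodS IH IH) _.
  apply/lie_prod_subP => u v /memv_addP[a aI [b bJ ->]].
  move=> /memv_addP[c cI [d dJ ->]]; rewrite bracketDl bracketDr -addrA.
  rewrite memv_add ?mem_lie_prod //.
  by apply: memvD; [apply: ideal_memr | apply: ideal_meml].
exists (m + n)%N; apply/eqP; rewrite -subv0 -mJ /derived_series iterD.
by apply: derived_seriesS; have := h n; rewrite nI add0v.
Qed.

Lemma nilpotent_addv I J : is_ideal I -> is_ideal J ->
  nilpotent I -> nilpotent J -> nilpotent (I + J)%VS.
Proof.
move=> idI idJ [n nI] [m mJ].
pose pw U k : {vspace L} := if k is k'.+1 then lower_central_series k' U else fullv.
have idpw U k : is_ideal U -> is_ideal (pw U k).
  move=> idU; case: k => [|k]; first by rewrite /is_ideal subvf.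
  by elim: k => //= k IH; apply: ideal_lie_prod.
have pw_br U k a x : is_ideal U -> a \in U -> x \in pw U k ->
    bracket a x \in pw U k.+1.
  by case: k => [|k] idU aU xU; [apply: ideal_meml | apply: mem_lie_prod].
have pwS U k : is_ideal U -> (pw U k.+1 <= pw U k)%VS.
  move=> idU; case: k => [|k]; first exact: subvf.
  by apply/lie_prod_subP => u v _ vU; apply: ideal_memr (idpw _ k.+1 idU) vU.
have pw0 U k l : is_ideal U -> pw U k = 0%VS -> (k <= l)%N -> pw U l = 0%VS.
  move=> idU h /subnK <-; elim: (l - k)%N => [|j IH] //.
  by apply/eqP; rewrite -subv0 -IH addSn pwS.
have h k : (lower_central_series k (I + J)
    <= \sum_(p < k.+2) (pw I p :&: pw J (k.+1 - p)%N))%VS.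
  elim: k => [|k IH].
    rewrite /= subv_add; apply/andP; split.
      apply: subv_trans (sumv_sup (inord 1) isT (subvv _)).
      by rewrite inordK //= capvf.
    apply: subv_trans (sumv_sup (inord 0) isT (subvv _)).
    by rewrite inordK //= capfv.
  have hin q x : (q < k.+3)%N -> x \in pw I q -> x \in pw J (k.+2 - q)%N ->
      x \in (\sum_(p < k.+3) (pw I p :&: pw J (k.+2 - p)%N))%VS.
    move=> qk xI xJ; apply: subvP (sumv_sup (Ordinal qk) isT (subvv _)) _ _.
    by rewrite memv_cap; apply/andP.
  apply: subv_trans (lie_prodS (subvv _) IH) _.
  apply/lie_prod_subP => u v /memv_addP[a aI [b bJ ->]].
  move=> /memv_sumP[w wE ->].
  rewrite (big_morph (bracket (a + b)) (@bracketDr _ _ _) (bracketx0 _)).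
  apply: memv_suml => p _.
  have /memv_capP[wI wJ] := wE p isT; rewrite bracketDl memvD //.
    apply: (hin p.+1); first by rewrite ltnS.
      exact: pw_br.
    by rewrite subSS; apply: ideal_memr (idpw _ _ idJ) _.
  have pk : (p <= k.+1)%N by rewrite -ltnS.
  apply: (hin p); first by rewrite ltnW // ltnS.
    exact: ideal_memr (idpw _ _ idI) _.
  by rewrite subSn //; apply: pw_br.
exists (n + m)%N; apply/eqP; rewrite -subv0.
apply: subv_trans (h _) _; apply/subv_sumP => p _.
case: (leqP n.+1 p) => [np | pn].
  by rewrite (pw0 I n.+1 p) ?cap0v.
by rewrite (pw0 J m.+1 (_ - _)%N) ?capv0 // ltn_subRL -addnS; lia.
Qed.

Lemma ex_max_dim (P : {vspace L} -> Prop) : P 0%VS ->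
  exists2 U, P U & forall V, P V -> (\dim V <= \dim U)%N.
Proof.
move=> P0; pose Q d := `[< exists2 U, P U & \dim U = d >].
have exQ : exists d, Q d by exists 0%N; apply/asboolP; exists 0%VS; rewrite ?dimv0.
have bQ d : Q d -> (d <= \dim (@fullv _ L))%N.
  by move=> /asboolP[U _ <-]; rewrite dimvS ?subvf.
case: (ex_maxnP exQ bQ) => d /asboolP[U PU dU] maxd.
by exists U => // V PV; rewrite dU maxd //; apply/asboolP; exists V.
Qed.

Lemma ex_largest (P : {vspace L} -> Prop) : P 0%VS ->
  (forall U V, P U -> P V -> P (U + V)%VS) ->
  exists2 U, P U & forall V, P V -> (V <= U)%VS.
Proof.
move=> P0 PD; have [U PU maxU] := ex_max_dim P0.
exists U => // V PV; have /maxU dUV := PD _ _ PU PV.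
suff -> : U = (U + V)%VS by apply: addvSr.
by apply/eqP; rewrite eqEdim addvSl.
Qed.

Lemma ex_radical : exists I, is_radical I.
Proof.
have [||I [idI sI] maxI] := @ex_largest (fun I => is_ideal I /\ solvable I).
- by split; [apply: ideal0 | apply: solvable0].
- by move=> I J [? ?] [? ?]; split; [apply: ideal_addv | apply: solvable_addv].
by exists I; split=> // J ? ?; apply: maxI.
Qed.

Lemma ex_nilradical : exists I, is_nilradical I.
Proof.
have [||I [idI sI] maxI] := @ex_largest (fun I => is_ideal I /\ nilpotent I).
- by split; [apply: ideal0 | apply: nilpotent0].
- by move=> I J [? ?] [? ?]; split; [apply: ideal_addv | apply: nilpotent_addv].
by exists I; split=> // J ? ?; apply: maxI.
Qed.

Definition is_generated (A : set L) U : Prop :=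
  [/\ is_subalgebra U, A `<=` [set x | x \in U]
    & forall V, is_subalgebra V -> A `<=` [set x | x \in V] -> (U <= V)%VS]%classic.

Lemma ex_generated (A : set L) : exists U, is_generated A U.
Proof.
pose Q d := `[< exists2 U, is_subalgebra U /\ (A `<=` [set x | x \in U])%classic
                         & \dim U = d >].
have exQ : exists d, Q d.
  exists (\dim (@fullv _ L)); apply/asboolP; exists fullv => //.
  by split; [apply: subvf | move=> x _ /=; apply: memvf].
case: (ex_minnP exQ) => d /asboolP[U [sU AU] dU] mind.
exists U; split=> // V sV AV; suff <- : (U :&: V)%VS = U by apply: capvSr.
apply/eqP; rewrite eqEdim capvSl dU mind //; apply/asboolP.
exists (U :&: V)%VS => //; split.
  apply/lie_prod_subP => u v /memv_capP[uU uV] /memv_capP[vU vV].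
  by rewrite memv_cap (lie_prod_subP _ _ _ sU) ?(lie_prod_subP _ _ _ sV).
by move=> x Ax /=; rewrite memv_cap (AU _ Ax) (AV _ Ax).
Qed.

Lemma ex_vspace_of (P : L -> Prop) : P 0 ->
  (forall a x y, P x -> P y -> P (a *: x + y)) ->
  exists U, forall x, x \in U <-> P x.
Proof.
move=> P0 Plin; have PD x y : P x -> P y -> P (x + y).
  by move=> Px Py; rewrite -[x]scale1r; apply: Plin.
have PZ a x : P x -> P (a *: x).
  by move=> Px; rewrite -[_ *: _]addr0; apply: Plin.
have [||U PU maxU] := @ex_largest (fun U => forall x, x \in U -> P x).
- by move=> x; rewrite memv0 => /eqP->.
- by move=> U V PU PV x /memv_addP[u /PU Pu [v /PV Pv ->]]; apply: PD.
exists U => x; split=> [/PU //|Px].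
have /maxU : forall y, y \in <[x]>%VS -> P y by move=> y /vlineP[a ->]; apply: PZ.
by rewrite -memvE.
Qed.

End LieSubspaces.

Structure subLie (K : fieldType) (L : finLieAlgebraType K) := SubLie {
  subLie_space :> {vspace L};
  subLieP : is_subalgebra subLie_space
}.

Structure lieIdeal (K : fieldType) (L : finLieAlgebraType K) := LieIdeal {
  lieIdeal_space :> {vspace L};
  lieIdealP : is_ideal lieIdeal_space
}.

Section Canonical.
Variables (K : fieldType) (L : finLieAlgebraType K).

Definition radical : lieIdeal L :=
  let I := cid (ex_radical L) in
  LieIdeal (let: And3 h _ _ := projT2 I in h).

Lemma radicalP : is_radical radical.
Proof. by rewrite /radical /=; case: cid. Qed.

Definition nilradical : lieIdeal L :=
  let I := cid (ex_nilradical L) in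
  LieIdeal (let: And3 h _ _ := projT2 I in h).

Lemma nilradicalP : is_nilradical nilradical.
Proof. by rewrite /nilradical /=; case: cid. Qed.

Definition lie_generated (A : set L) : subLie L :=
  let U := cid (ex_generated A) in
  SubLie (let: And3 h _ _ := projT2 U in h).

Lemma lie_generatedP (A : set L) : is_generated A (lie_generated A).
Proof. by rewrite /lie_generated /=; case: cid. Qed.

Record lie_closed (P : L -> Prop) : Prop := LieClosed {
  lie_closed0 : P 0;
  lie_closed_lin : forall a x y, P x -> P y -> P (a *: x + y);
  lie_closed_bracket : forall x y, P x -> P y -> P (bracket x y)
}.

Lemma subLie_of_subproof (P : L -> Prop) (cP : lie_closed P) :
  is_subalgebra
    (projT1 (cid (ex_vspace_of (lie_closed0 cP) (lie_closed_lin cP)))).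
Proof.
case: cid => U UP /=; apply/lie_prod_subP => u v /UP Pu /UP Pv.
by apply/UP; apply: lie_closed_bracket cP _ _ Pu Pv.
Qed.

Definition subLie_of (P : L -> Prop) (cP : lie_closed P) : subLie L :=
  SubLie (subLie_of_subproof cP).

Lemma mem_subLie_of (P : L -> Prop) (cP : lie_closed P) x :
  x \in (subLie_of cP : {vspace L}) <-> P x.
Proof. by rewrite /subLie_of /=; case: cid. Qed.

End Canonical.

Definition lie_of (K : fieldType) (L : finLieAlgebraType K) (S : subLie L) :
  Type := subvs_of S.
Coercion lie_of : subLie >-> Sortclass.

Section SubLieAlgebra.
Variables (K : fieldType) (L : finLieAlgebraType K) (S : subLie L).
HB.instance Definition _ := Vector.on (lie_of S).

Definition sub_bracket (x y : lie_of S) : lie_of S :=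
  Subvs (lie_prod_subP _ _ _ (subLieP S) _ _ (subvsP x) (subvsP y)).

Fact sub_bracketPl y : linear (sub_bracket^~ y).
Proof. by move=> a x z; apply: val_inj => /=; rewrite bracketDl bracketZl. Qed.
Fact sub_bracketPr x : linear (sub_bracket x).
Proof. by move=> a y z; apply: val_inj => /=; rewrite bracketDr bracketZr. Qed.
Fact sub_bracketxx x : sub_bracket x x = 0.
Proof. by apply: val_inj => /=; rewrite bracketxx. Qed.
Fact sub_bracket_jacobi x y z :
  sub_bracket x (sub_bracket y z) + sub_bracket y (sub_bracket z x)
    + sub_bracket z (sub_bracket x y) = 0.
Proof. by apply: val_inj; apply: bracket_jacobi. Qed.

HB.instance Definition _ := Lmodule_isLie.Build K (lie_of S)
  sub_bracketPl sub_bracketPr sub_bracketxx sub_bracket_jacobi.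
End SubLieAlgebra.

Section LieQuotient.
Variables (K : fieldType) (L : finLieAlgebraType K) (I : lieIdeal L).
Local Open Scope quotient_scope.

Definition lie_quot := {ideal_quot (pred_of_vspace I)}.
HB.instance Definition _ := GRing.Zmodule.on lie_quot.
HB.instance Definition _ := EqQuotient.on lie_quot.

Definition lie_proj (x : L) : lie_quot := \pi_lie_quot x.

Lemma lie_projE x y : (lie_proj x == lie_proj y) = (x - y \in I).
Proof. by rewrite Quotient.idealrBE. Qed.

Lemma lie_projD x y : lie_proj (x + y) = lie_proj x + lie_proj y.
Proof. by rewrite /lie_proj !piE. Qed.

Lemma lie_projK (u : lie_quot) : lie_proj (repr u) = u.
Proof. exact: reprK. Qed.

Definition quot_scale (a : K) (u : lie_quot) : lie_quot :=
  lie_proj (a *: repr u).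
Definition quot_bracket (u v : lie_quot) : lie_quot :=
  lie_proj (bracket (repr u) (repr v)).

Lemma repr_projP x : repr (lie_proj x) - x \in I.
Proof. by rewrite -lie_projE lie_projK. Qed.

Lemma lie_projZ a x : lie_proj (a *: x) = quot_scale a (lie_proj x).
Proof.
by apply/eqP; rewrite eq_sym lie_projE -scalerBr memvZ ?repr_projP.
Qed.

Lemma lie_proj_bracket x y :
  lie_proj (bracket x y) = quot_bracket (lie_proj x) (lie_proj y).
Proof.
apply/eqP; rewrite eq_sym lie_projE.
set x' := repr _; set y' := repr _.
have -> : bracket x' y' - bracket x y
    = bracket (x' - x) y' + bracket x (y' - y).
  by rewrite bracketDl bracketDr -(scaleN1r x) -(scaleN1r y) bracketZl bracketZr
    !scaleN1r addrA subrK.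
apply: memvD; [apply: ideal_meml | apply: ideal_memr];
  by rewrite ?lieIdealP // repr_projP.
Qed.

Fact quot_scaleA a b u : quot_scale a (quot_scale b u) = quot_scale (a * b) u.
Proof. by rewrite -[u]lie_projK -!lie_projZ scalerA. Qed.
Fact quot_scale1 : left_id 1 quot_scale.
Proof. by move=> u; rewrite -[u]lie_projK -!lie_projZ scale1r. Qed.
Fact quot_scaleDr : right_distributive quot_scale +%R.
Proof.
move=> a u v; rewrite -[u]lie_projK -[v]lie_projK.
by rewrite -lie_projD -!lie_projZ -lie_projD scalerDr.
Qed.
Fact quot_scaleDl u : {morph quot_scale^~ u : a b / a + b}.
Proof.
by move=> a b; rewrite -[u]lie_projK -!lie_projZ -lie_projD scalerDl.
Qed.
HB.instance Definition _ := GRing.Zmodule_isLmodule.Build K lie_quot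
  quot_scaleA quot_scale1 quot_scaleDr quot_scaleDl.

Lemma lie_projP a x y : lie_proj (a *: x + y) = a *: lie_proj x + lie_proj y.
Proof. by rewrite lie_projD lie_projZ. Qed.

Fact quot_bracketPl v : linear (quot_bracket^~ v).
Proof.
move=> a u w; rewrite -[u]lie_projK -[v]lie_projK -[w]lie_projK.
by rewrite -lie_projP -!lie_proj_bracket -lie_projP bracketDl bracketZl.
Qed.
Fact quot_bracketPr u : linear (quot_bracket u).
Proof.
move=> a v w; rewrite -[u]lie_projK -[v]lie_projK -[w]lie_projK.
by rewrite -lie_projP -!lie_proj_bracket -lie_projP bracketDr bracketZr.
Qed.
Fact quot_bracketxx u : quot_bracket u u = 0.
Proof.
rewrite -[u]lie_projK -lie_proj_bracket bracketxx.
by apply: (addrI (lie_proj 0)); rewrite -lie_projD !addr0.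
Qed.
Fact quot_bracket_jacobi u v w :
  quot_bracket u (quot_bracket v w) + quot_bracket v (quot_bracket w u)
    + quot_bracket w (quot_bracket u v) = 0.
Proof.
rewrite -[u]lie_projK -[v]lie_projK -[w]lie_projK -!lie_proj_bracket.
rewrite -!lie_projD bracket_jacobi.
by apply: (addrI (lie_proj 0)); rewrite -lie_projD !addr0.
Qed.
HB.instance Definition _ := Lmodule_isLie.Build K lie_quot
  quot_bracketPl quot_bracketPr quot_bracketxx quot_bracket_jacobi.
End LieQuotient.

Section Orthogonal.
Variables (K : fieldType) (n : nat).

(* The standard form of so_n: skew-symmetric matrices. *)
Definition skew (A : 'M[K]_n) : Prop := A^T = - A.

Fact skew_lie_closed : lie_closed skew.
Proof.
split=> [|a A B sA sB|A B sA sB]; rewrite /skew.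
- by rewrite trmx0 oppr0.
- by rewrite linearP /= sA sB scalerN opprD.
- by rewrite /bracket /= /mx_bracket linearB /= !trmx_mul sA sB !mulNmx !mulmxN
    !opprK opprB.
Qed.

Definition so : subLie 'M[K]_n := subLie_of skew_lie_closed.
End Orthogonal.
Arguments so K n : clear implicits.

(* Matrices of size 22 - k are written in blocks of sizes 1, m, 1, with
   m = 20 - k. *)
Definition Psi (K : fieldType) (m : nat) (Psi' : 'M[K]_m) :
    'M[K]_(1 + (m + 1)) :=
  block_mx 0                 (row_mx 0 1%:M)
           (col_mx 0 1%:M)   (block_mx Psi' 0
                                       0    0).

Definition block_lower (R : nzRingType) (m : nat) (B : 'M[R]_(1 + (m + 1))) :
    Prop :=
  ursubmx B = 0 /\ ursubmx (drsubmx B) = 0.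

Lemma ursubmxP (R : pzRingType) m1 m2 n1 n2 a (A B : 'M[R]_(m1 + m2, n1 + n2)) :
  ursubmx (a *: A + B) = a *: ursubmx A + ursubmx B.
Proof. by apply/matrixP => i j; rewrite !mxE. Qed.

Lemma drsubmxP (R : pzRingType) m1 m2 n1 n2 a (A B : 'M[R]_(m1 + m2, n1 + n2)) :
  drsubmx (a *: A + B) = a *: drsubmx A + drsubmx B.
Proof. by apply/matrixP => i j; rewrite !mxE. Qed.

(* The algebraic group as its functor of points on commutative K-algebras.
   The condition on g^T says that g^T respects the Hodge filtration; g is
   automatically invertible when Psi' is. *)
Definition G_points (K : fieldType) (m : nat) (Psi' : 'M[K]_m)
    (A : comAlgType K) (g : 'M[A]_(1 + (m + 1))) : Prop :=
  let PsiA := map_mx (in_alg A) (Psi Psi') in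
  g^T *m PsiA *m g = PsiA /\ block_lower g^T.

Definition dual_numbers (K : fieldType) := {poly %/ 'X^2 : {poly K}}.
HB.instance Definition _ (K : fieldType) :=
  GRing.ComUnitAlgebra.on (dual_numbers K).

(* The tangent space at 1: those x such that 1 + eps x is a point of G with
   values in the dual numbers. *)
Definition tangent_G (K : fieldType) (m : nat) (Psi' : 'M[K]_m)
    (x : 'M[K]_(1 + (m + 1))) : Prop :=
  G_points Psi'
    (1%:M + ('qX : dual_numbers K) *: map_mx (in_alg (dual_numbers K)) x).

Section LieG.
Variables (K : fieldType) (m : nat) (Psi' : 'M[K]_m).
Local Notation D := (dual_numbers K).
Local Notation eps := ('qX : D).
Local Notation P := (Psi Psi').
Local Notation lift x := (map_mx (in_alg D) x).

Lemma eps_val : val eps = 'X.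
Proof. by apply: qpolyXE; rewrite ?size_polyXn ?monicXn. Qed.

Lemma eps2 : eps * eps = 0.
Proof.
apply: val_inj; apply: (etrans (poly_of_qpolyM _ _)).
rewrite [polyn _]eps_val -expr2; transitivity (0 : {poly K}) => //.
by rewrite mk_monic_Xn Pdiv.RingMonic.rmodpp ?monicXn.
Qed.

Lemma eps_lift_eq0 p q (x : 'M[K]_(p, q)) : (eps *: lift x == 0) = (x == 0).
Proof.
apply/eqP/eqP => [/matrixP h | ->]; last by rewrite map_mx0 scaler0.
apply/matrixP => i j; have := h i j; rewrite !mxE /= -scalerAr mulr1.
move=> /(congr1 val) h1; have {h1} : x i j *: 'X = 0 :> {poly K}.
  by rewrite -eps_val; apply: h1.
by move=> /(congr1 (fun r : {poly K} => r`_1)); rewrite coefZ coefX mulr1 coef0.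
Qed.

Lemma tangent_GE x : tangent_G Psi' x <-> x^T *m P + P *m x = 0 /\ block_lower x^T.
Proof.
have block1 : block_lower (1%:M : 'M[D]_(1 + (m + 1))).
  by rewrite /block_lower !scalar_mx_block block_mxKur block_mxKdr block_mxKur.
have trE : (1%:M + eps *: lift x)^T = 1%:M + eps *: lift x^T.
  by rewrite linearD linearZ /= trmx1 map_trmx.
rewrite /tangent_G /G_points trE.
set e1 := (X in X /\ _ <-> _); set e2 := (X in _ /\ X <-> _).
have -> : e1 <-> x^T *m P + P *m x = 0.
  rewrite /e1 mulmxDl mul1mx mulmxDr mulmx1 mulmxDl -!scalemxAl -!scalemxAr.
  rewrite scalerA eps2 scale0r addr0 -addrA -!map_mxM -scalerDr -map_mxD.
  split=> [/eqP|->]; last by rewrite map_mx0 scaler0 addr0.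
  by rewrite addrC -subr_eq0 addrK eps_lift_eq0 => /eqP.
have -> // : e2 <-> block_lower x^T.
rewrite /e2; case: block1 => b1 b2; rewrite /block_lower.
rewrite [1%:M + _]addrC drsubmxP !ursubmxP b1 b2 !addr0.
rewrite -map_drsubmx -!map_ursubmx.
by split=> -[/eqP h1 /eqP h2]; split; apply/eqP; rewrite ?eps_lift_eq0 // -eps_lift_eq0.
Qed.

Fact tangent_G_lie_closed : lie_closed (tangent_G Psi').
Proof.
split=> [|a x y|x y].
- apply/tangent_GE; rewrite trmx0 mul0mx mulmx0 addr0 /block_lower.
  by do 2?split; apply/matrixP => i j; rewrite !mxE.
- move=> /tangent_GE[ex [x1 x2]] /tangent_GE[ey [y1 y2]]; apply/tangent_GE.
  rewrite linearP /= mulmxDl mulmxDr -scalemxAl -scalemxAr addrACA -scalerDr.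
  rewrite ex ey scaler0 addr0 /block_lower; split=> //.
  by rewrite drsubmxP !ursubmxP x1 x2 y1 y2 !scaler0 !addr0.
- move=> /tangent_GE[ex bx] /tangent_GE[ey bY]; apply/tangent_GE.
  have Ex : x^T *m P = - (P *m x) by apply/eqP; rewrite -addr_eq0 ex.
  have Ey : y^T *m P = - (P *m y) by apply/eqP; rewrite -addr_eq0 ey.
  rewrite /bracket /= /mx_bracket linearB /= !trmx_mul.
  split.
    rewrite mulmxBl mulmxBr -!mulmxA Ex Ey !mulmxN !mulmxA Ex Ey !mulNmx !opprK.
    by rewrite addrA subrK subrr.
  have mulP (A B : 'M[K]_(1 + (m + 1))) :
      block_lower A -> block_lower B -> block_lower (A *m B).
    rewrite /block_lower -[A]submxK -[B]submxK mulmx_block.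
    rewrite !block_mxKur !block_mxKdr => -[-> a2] [-> b2].
    rewrite !(mul0mx, mulmx0, addr0, add0r) -[drsubmx A]submxK -[drsubmx B]submxK.
    by rewrite mulmx_block block_mxKur a2 b2 mul0mx mulmx0 addr0.
  have [h1 h2] := mulP _ _ bY bx; have [h3 h4] := mulP _ _ bx bY.
  rewrite /block_lower -[- _]scaleN1r [_ + _]addrC drsubmxP !ursubmxP.
  by rewrite h1 h2 h3 h4 !scaler0 !addr0.
Qed.

Definition LieG : subLie 'M[K]_(1 + (m + 1)) := subLie_of tangent_G_lie_closed.

Lemma mem_LieG x : x \in (LieG : {vspace _}) <-> tangent_G Psi' x.
Proof. exact: mem_subLie_of. Qed.

Definition nilradical_transpose : set 'M[K]_(1 + (m + 1)) :=
  [set x | exists2 y : LieG,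
     y \in (nilradical LieG : {vspace _}) & x = (vsval y)^T]%classic.

(* Pitfall: transposition is not compatible with a change of basis.  When
   m > 0 the transposed nilradical lies in the orthogonal Lie algebra of
   Psi Psi' only if Psi' *m Psi' = 1%:M (e.g. Psi' the identity or the
   antidiagonal permutation matrix); otherwise AMSY is strictly larger. *)
Definition AMSY : subLie 'M[K]_(1 + (m + 1)) :=
  lie_generated
    ([set x | x \in (LieG : {vspace _})] `|` nilradical_transpose)%classic.
End LieG.

(* Main.v *)
Require Import Defs.
From HB Require Import structures.
From mathcomp Require Import all_boot all_order all_algebra.
From mathcomp Require Import boolp classical_sets reals.
From mathcomp Require Import zify.
From mathcomp.real_closed Require Import complex.

Set Implicit Arguments.
Unset Strict Implicit.
Unset Printing Implicit Defensive.
Import Order.TTheory GRing.Theory Num.Theory.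
Local Open Scope ring_scope.
Local Open Scope complex_scope.

(** Write m = 20 - k.  An element of Lie(G) is determined by a scalar a, an
    element s of so(Psi') and a column v: it has diagonal blocks a, s, -a and v
    above the last diagonal block.  The map x |-> s is a surjective morphism of
    Lie algebras onto so(Psi'), and its kernel, of dimension m + 1, is solvable.
    For m <> 2 the algebra so_m has no nonzero abelian ideal, so this kernel is
    the radical.  A complex symmetric invertible matrix is of the form C^T C,
    and conjugation by C identifies so(Psi') with so_m.

    The elements with a = 0 and s = 0 form an abelian ideal V, which lies in the
    nilradical.  When Psi'^2 = 1, also Psi^2 = 1, hence so(Psi) is stable under
    transposition, and so(Psi) = Lie(G) + V^T already as a vector space; thus
    AMSY = so(Psi), which is again a conjugate of so_(m+2). *)

(** * Skew-symmetric matrices with vanishing double brackets *)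

(* The (a, b) entry of [x, [x, y]] = 0 for y = delta_ij - delta_ji, after
   expansion as x^2 y + y x^2 = 2 x y x. *)
Lemma sandwich_entries (K : fieldType) n (x : 'M[K]_n) (a b i j : 'I_n) :
  (forall y : 'M_n, y^T = - y -> bracket x (bracket x y) = 0) ->
  (x *m x) a i *+ (j == b) - (x *m x) a j *+ (i == b)
  + (x *m x) j b *+ (a == i) - (x *m x) i b *+ (a == j)
  = (x a i * x j b - x a j * x i b) *+ 2.
Proof.
move=> sx.
have subE (A B : 'M[K]_n) : (A - B) a b = A a b - B a b by rewrite !mxE.
have [y yE] : exists y : 'M[K]_n, y = delta_mx i j - delta_mx j i by eexists.
have sy : y^T = - y by rewrite yE linearB /= !trmx_delta opprB.
have dl (A : 'M[K]_n) i' j' : (A *m delta_mx i' j') a b = A a i' *+ (j' == b).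
  rewrite !mxE (bigD1 i') //= big1 ?addr0 => [|l /negPf ne].
    by rewrite mxE eqxx eq_sym /= mulr_natr.
  by rewrite mxE ne mulr0.
have dr (A : 'M[K]_n) i' j' : (delta_mx i' j' *m A) a b = A j' b *+ (a == i').
  rewrite !mxE (bigD1 j') //= big1 ?addr0 => [|l /negPf ne].
    by rewrite mxE eqxx andbT mulr_natl.
  by rewrite mxE ne andbF mul0r.
have dm i' j' : (x *m delta_mx i' j' *m x) a b = x a i' * x j' b.
  rewrite mxE (bigD1 j') //= big1 ?addr0 => [|l /negPf ne].
    rewrite mxE (bigD1 i') //= big1 ?addr0 => [|l /negPf ne].
      by rewrite mxE !eqxx mulr1.
    by rewrite mxE ne mulr0.
  by rewrite mxE big1 ?mul0r // => l' _; rewrite mxE ne andbF mulr0.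
have e2 : x *m x *m y + y *m (x *m x) = (x *m y *m x) *+ 2.
  have := sx y sy; rewrite /bracket /= /mx_bracket mulmxBr mulmxBl !mulmxA.
  rewrite opprB addrACA -opprD -mulr2n => /eqP.
  by rewrite subr_eq0 => /eqP.
have /matrixP /(_ a b) := e2; rewrite mulmxnE.
have -> : (x *m x *m y + y *m (x *m x)) a b =
  (x *m x) a i *+ (j == b) - (x *m x) a j *+ (i == b)
  + ((x *m x) j b *+ (a == i) - (x *m x) i b *+ (a == j)).
  by rewrite mxE yE mulmxBr mulmxBl !subE !dl !dr.
by rewrite addrA => ->; rewrite yE mulmxBr mulmxBl subE !dm.
Qed.

(** Put s_i = (x^2)_ii. For i <> j the (i, j) entry with y = delta_ij - delta_ji gives s_i + s_j = -
    2 x_ij^2. Summing over j, tr(x^2) + n s_i = 4 s_i; summing over i, 2n tr(x^2) = 4 tr(x^2), so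
    the trace vanishes as n <> 2. For n <> 4 every s_i then vanishes, hence every x_ij. *)
Lemma sandwich_skew (K : numFieldType) n (x : 'M[K]_n) :
  n <> 2 -> x^T = - x ->
  (forall y : 'M_n, y^T = - y -> bracket x (bracket x y) = 0) -> x = 0.
Proof.
move=> n2 skx sx; have xC i j : x j i = - x i j.
  by have /matrixP/(_ i j) := skx; rewrite !mxE.
have n20 : 2 != 0 :> K by rewrite pnatr_eq0.
have eq2 (c : K) : c *+ 2 = 0 -> c = 0.
  by rewrite -mulr_natr => /eqP; rewrite mulf_eq0 (negPf n20) orbF => /eqP.
have xx i : x i i = 0.
  by apply: eq2; rewrite mulr2n {1}xC addNr.
pose s i := (x *m x) i i.
have sE i : s i = - \sum_j x i j ^+ 2.
  rewrite /s mxE -sumrN; apply: eq_bigr => j _.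
  by rewrite (xC i j) mulrN expr2.
have h1 i j : i != j -> s i + s j = - (x i j ^+ 2) *+ 2.
  move=> ij; have := @sandwich_entries K n x i j i j sx.
  by rewrite !eqxx (negPf ij) !mulr1n !mulr0n !subr0 !xx mul0r sub0r expr2.
have h2 i : (\sum_j s j) + s i *+ n = s i *+ 4.
  have : \sum_j (s i + s j)
      = \sum_j (- (x i j ^+ 2) *+ 2 + (if j == i then s i *+ 2 else 0)).
    apply: eq_bigr => j _; case: eqVneq => [->|ne].
      by rewrite xx expr0n oppr0 mul0rn add0r mulr2n.
    by rewrite addr0 h1 // eq_sym.
  rewrite !big_split /= sumr_const card_ord addrC => ->.
  rewrite -big_mkcond big_pred1_eq.
  by rewrite sumrN -sE -mulr2n -mulrnDr.
have tr0 : \sum_j s j = 0.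
  have : \sum_i ((\sum_j s j) + s i *+ n) = \sum_i s i *+ 4.
    by apply: eq_bigr => i _; apply: h2.
  rewrite big_split /= sumr_const card_ord !sumrMnl -mulrnDr.
  case: (eqVneq (\sum_j s j) 0) => // ne /(mulrIn ne) nn; case: n2; lia.
apply/matrixP => i j; rewrite mxE; case: (eqVneq i j) => [->//|ij].
apply/eqP; rewrite -sqrf_eq0; apply/eqP.
have [n4|n4] := eqVneq n 4; last first.
  have s0 l : s l = 0.
    have := h2 l; rewrite tr0 add0r.
    by case: (eqVneq (s l) 0) => // ne /(mulrIn ne) nn; rewrite nn eqxx in n4.
  by apply/eqP; rewrite -oppr_eq0; apply/eqP/eq2; rewrite -h1 // !s0 addr0.
(* For n = 4 the diagonal relations only give x_ij^2 = - x_kl^2; the other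
   entries add x_ij x_kl = x_ik x_jl, and its two permutations force these
   products to vanish. *)
have /eqP/cards2P[k [l [kl ckl]]] : #|~: [set i; j]| = 2.
  by have := cardsC [set i; j]; rewrite cards2 ij card_ord; move: n4; lia.
have memE a : a \notin [set i; j] = (a \in [set k; l]) by rewrite -ckl !inE.
have := memE k; have := memE l; rewrite !inE !eqxx !negb_or orbT /=.
move=> /andP[li lj] /andP[ki kj].
have sum0 : s i + s j + (s k + s l) = 0.
  rewrite -tr0 (bigID (mem [set i; j])) /= big_setU1 ?inE //= big_set1.
  by rewrite (eq_bigl _ _ memE) big_setU1 ?inE //= big_set1.
have h3 a b c d : uniq [:: a; b; c; d] -> x a b * x c d = x a c * x b d.
  move=> /= /and4P[]; rewrite !inE !negb_or => /and3P[/negPf ab /negPf ac _].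
  move=> /andP[/negPf bc /negPf bd] /negPf cd _.
  have := @sandwich_entries K n x a d b c sx.
  rewrite ab ac bd cd !mulr0n !subr0 addr0 => /esym/eq2/eqP.
  by rewrite subr_eq0 => /eqP.
have uijkl : uniq [:: i; j; k; l].
  by rewrite /= !inE !negb_or ij kl !(eq_sym i) !(eq_sym j) ki li kj lj.
have h3p t : perm_eq t [:: i; j; k; l] -> uniq t by move/perm_uniq->.
have e1 : x i j * x k l = x i k * x j l by apply: h3.
have e2 : x i j * x l k = x i l * x j k.
  by apply/h3/h3p; rewrite !perm_cons (perm_catC [:: l] [:: k]).
have e3 : x i k * x l j = x i l * x k j.
  by apply/h3/h3p; rewrite perm_cons (perm_catC [:: k; l] [:: j]).
have p0 : x i j * x k l = 0.
  apply: eq2; rewrite mulr2n {2}e1; apply/eqP; rewrite addr_eq0 -mulrN -xC e3.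
  by rewrite (xC j k) mulrN -e2 (xC k l) mulrN opprK.
have q0 : x i j ^+ 2 = - x k l ^+ 2.
  apply/eqP; rewrite -addr_eq0 -oppr_eq0 opprD; apply/eqP/eq2.
  by rewrite mulrnDl -!h1.
(* Replacing one factor x_ij^2 by - x_kl^2 gives x_ij^4 = - (x_ij x_kl)^2 = 0. *)
by apply/eqP; rewrite -sqrf_eq0 expr2 {2}q0 mulrN -exprMn p0 expr0n oppr0 eqxx.
Qed.

(** * Morphisms of Lie algebras, quotients and radicals *)

Section LieMorphisms.
Variables (K : fieldType) (L1 L2 : finLieAlgebraType K) (f : 'Hom(L1, L2)).
Hypothesis f_bracket : forall x y, f (bracket x y) = bracket (f x) (f y).
Implicit Types U V J : {vspace L1}.

Lemma limg_lie_prod U V : (f @: lie_prod U V)%VS = lie_prod (f @: U) (f @: V).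
Proof.
apply/eqP; rewrite eqEsubv; apply/andP; split; last first.
  apply/lie_prod_subP => _ _ /memv_imgP[u uU ->] /memv_imgP[v vV ->].
  by rewrite -f_bracket memv_img ?mem_lie_prod.
apply/subvP => _ /memv_imgP[w wUV ->]; rewrite memv_preim.
apply: subvP w wUV; apply/lie_prod_subP => u v uU vV.
by rewrite -memv_preim f_bracket mem_lie_prod ?memv_img.
Qed.

Lemma limg_solvable J : solvable J -> solvable (f @: J)%VS.
Proof.
move=> [n Jn]; exists n; rewrite -(limg0 f) -Jn.
by elim: n {Jn} => //= n ->; rewrite limg_lie_prod.
Qed.

Lemma limg_ideal J : limg f = fullv -> is_ideal J -> is_ideal (f @: J)%VS.
Proof. by rewrite /is_ideal => <- idJ; rewrite -limg_lie_prod limgS. Qed.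

Lemma lker_ideal : is_ideal (lker f).
Proof.
apply/idealP => x y; rewrite !memv_ker f_bracket => /eqP->.
by rewrite bracketx0.
Qed.

(** First isomorphism theorem: [f] at a chosen representative is independent of the choice, since
    two representatives differ by an element of the kernel. *)
Lemma quotient_isomorphic (I : lieIdeal L1) :
  limg f = fullv -> (I : {vspace L1}) = lker f ->
  lie_isomorphic (lie_quot I) L2.
Proof.
move=> surj IE; pose g (u : lie_quot I) := f (repr u).
have gE x : g (lie_proj I x) = f x.
  by apply/eqP; rewrite /g -subr_eq0 -linearB /= -memv_ker -IE repr_projP.
have g_lin : linear g.
  move=> a u v; rewrite -[u]lie_projK -[v]lie_projK -lie_projP !gE.
  exact: linearP.
pose gl : {linear lie_quot I -> L2} :=
  HB.pack g (GRing.isLinear.Build K (lie_quot I) L2 _ g g_lin).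
exists gl; split=> [|u v]; last first.
  rewrite /= -[u]lie_projK -[v]lie_projK.
  have -> : bracket (lie_proj I (repr u)) (lie_proj I (repr v))
    = lie_proj I (bracket (repr u) (repr v)) by rewrite lie_proj_bracket.
  by rewrite !gE f_bracket.
exists (fun y => lie_proj I ((f^-1)%VF y)) => [u|y] /=.
  rewrite -[u]lie_projK gE; apply/eqP; rewrite lie_projE IE memv_ker linearB /=.
  by rewrite limg_lfunVK ?subrr // surj memvf.
by rewrite gE limg_lfunVK // surj memvf.
Qed.

End LieMorphisms.

Section NoAbelianIdeal.
Variables (K : fieldType) (L : finLieAlgebraType K).

Lemma derived_series_ideal n (J : {vspace L}) :
  is_ideal J -> is_ideal (derived_series n J).
Proof. by move=> idJ; elim: n => //= n IH; apply: ideal_lie_prod. Qed.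

(** The last nonzero term of the derived series of a solvable ideal would be a nonzero abelian
    ideal. *)
Lemma solvable_ideal_eq0 :
  (forall J : {vspace L}, is_ideal J -> lie_prod J J = 0%VS -> J = 0%VS) ->
  forall J : {vspace L}, is_ideal J -> solvable J -> J = 0%VS.
Proof.
move=> ab0 J idJ [n]; elim: n => // n IH Jn; apply: IH.
by apply: ab0 => //; apply: derived_series_ideal.
Qed.

End NoAbelianIdeal.

(** The kernel is a solvable ideal, so it lies in the radical. Conversely the image of the radical
    is a solvable ideal of [L2], hence zero. *)
Lemma radical_lker (K : fieldType) (L1 L2 : finLieAlgebraType K)
    (f : 'Hom(L1, L2)) :
  (forall x y, f (bracket x y) = bracket (f x) (f y)) ->
  limg f = fullv -> solvable (lker f) ->
  (forall J : {vspace L2}, is_ideal J -> lie_prod J J = 0%VS -> J = 0%VS) ->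
  (radical L1 : {vspace L1}) = lker f.
Proof.
move=> fM surj solk ab0; have [idR solR maxR] := radicalP L1.
apply/eqP; rewrite eqEsubv maxR ?lker_ideal // andbT.
have := solvable_ideal_eq0 ab0 (limg_ideal fM surj idR) (limg_solvable fM solR).
by move=> fR0; apply/subvP => x xR; rewrite memv_ker -memv0 -fR0 memv_img.
Qed.

(** * Symmetric matrices over an algebraically closed field *)

(** Gram-Schmidt: [W] is extended by a vector u of its orthogonal complement [N] with u A u^T <> 0,
    divided by a square root of that value. Such a u exists because otherwise the form would vanish
    on [N], and [N] would be orthogonal to the whole space. *)
Lemma orthonormal_rows (K : numClosedFieldType) n (A : 'M[K]_n) r :
  A^T = A -> A \in unitmx -> (r <= n)%N ->
  exists W : 'M[K]_(r, n), W *m A *m W^T = 1%:M.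
Proof.
move=> symA unA; have tr11 (M : 'M[K]_1) : M^T = M.
  by apply/matrixP => i j; rewrite !ord1 mxE.
elim: r => [|r IH] rn.
  by exists 0; apply/matrixP => -[].
have [W WW] := IH (ltnW rn); pose N := kermx (A *m W^T).
have N0 : N != 0.
  rewrite -mxrank_eq0 mxrank_ker subn_eq0 -ltnNge.
  exact: leq_ltn_trans (rank_leq_col _) rn.
have [u uN uu] : exists2 u : 'rV_n, (u <= N)%MS & u *m A *m u^T != 0.
  apply: contrapT => no.
  have q0 (u : 'rV_n) : (u <= N)%MS -> u *m A *m u^T = 0.
    by move=> uN; apply/eqP; apply: contrapT => /negP uu; apply: no; exists u.
  (* Polarization: expanding the form at u + v leaves 2 u A v^T = 0. *)
  have b0 (u v : 'rV_n) : (u <= N)%MS -> (v <= N)%MS -> u *m A *m v^T = 0.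
    move=> uN vN; have := q0 _ (addmx_sub uN vN).
    rewrite linearD /= mulmxDr !mulmxDl !q0 // add0r addr0.
    have -> : v *m A *m u^T = u *m A *m v^T.
      by rewrite -[LHS]tr11 !trmx_mul trmxK symA mulmxA.
    move/matrixP/(_ 0 0); rewrite !mxE -mulr2n -mulr_natr => /eqP.
    rewrite mulf_eq0 pnatr_eq0 orbF => /eqP h.
    by apply/matrixP => i j; rewrite !ord1 !mxE.
  case/eqP: N0; apply/row_matrixP => i; rewrite row0.
  have rN := row_sub i N.
  suff /(congr1 (fun M => M *m invmx A)) : row i N *m A = 0.
    by rewrite mulmxK // mul0mx.
  have NW : row i N *m A *m W^T = 0.
    by apply/eqP; rewrite -mulmxA -sub_kermx.
  apply/trmx_inj/row_matrixP => j; rewrite -!tr_col col0 colE -trmx_delta.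
  congr _^T.
  (* Subtracting c W projects the basis vector z onto [N]; row i of [N] is orthogonal to both
     summands of z. *)
  set z := delta_mx 0 j; set c := z *m A *m W^T.
  have zN : (z - c *m W <= N)%MS.
    apply/sub_kermxP; rewrite !mulmxA mulmxBl mulmxBl -/c -!(mulmxA c) WW.
    by rewrite mulmx1 subrr.
  rewrite -[z](subrK (c *m W)) linearD /= mulmxDr b0 // add0r.
  by rewrite trmx_mul mulmxA NW mul0mx.
have uW : u *m A *m W^T = 0 by apply/eqP; rewrite -mulmxA -sub_kermx.
have Wu : W *m A *m u^T = 0.
  by apply/trmx_inj; rewrite trmx0 !trmx_mul trmxK symA mulmxA.
pose d := sqrtC ((u *m A *m u^T) 0 0).
have d2 : d ^+ 2 = (u *m A *m u^T) 0 0 by rewrite sqrtCK.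
have d0 : d != 0.
  rewrite -sqrf_eq0 d2; apply: contra uu => /eqP e.
  by apply/eqP/matrixP => i j; rewrite !ord1 e mxE.
suff: col_mx (d^-1 *: u) W *m A *m (col_mx (d^-1 *: u) W)^T = 1%:M.
  by exists (col_mx (d^-1 *: u) W).
rewrite mul_col_mx tr_col_mx mul_col_row WW linearZ /= -!scalemxAl -!scalemxAr.
rewrite uW Wu !scaler0 scalerA [u *m A *m u^T]mx11_scalar -d2 scale_scalar_mx.
by rewrite -invfM -expr2 mulVf ?expf_neq0 // -scalar_mx_block.
Qed.

Lemma symmetric_congruent1 (K : numClosedFieldType) n (A : 'M[K]_n) :
  A^T = A -> A \in unitmx ->
  exists2 C : 'M[K]_n, C \in unitmx & A = C^T *m C.
Proof.
move=> symA unA; have [W WW] := orthonormal_rows symA unA (leqnn n).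
have unW : W \in unitmx.
  by have := unitmx1 K n; rewrite -WW !unitmx_mul => /andP[/andP[]].
exists (invmx W)^T; first by rewrite unitmx_tr unitmx_inv.
have unWT : W^T \in unitmx by rewrite unitmx_tr.
rewrite trmxK -[LHS](mulKmx unW) -[W *m A](mulmxK unWT).
by rewrite WW mul1mx trmx_inv.
Qed.

(** * Orthogonal Lie algebras of forms, and abelian ideals of so_n *)

Lemma vsval_bracket (K : fieldType) n (S : subLie 'M[K]_n) (x y : S) :
  vsval (bracket x y : S) = vsval x *m vsval y - vsval y *m vsval x.
Proof. by []. Qed.

(** Multiplying the left equation by C^-T on the left and C^-1 on the right turns it into y^T + y =
    0 for y = C x C^-1. *)
Lemma so_conj (K : fieldType) n (C x : 'M[K]_n) : C \in unitmx ->
  x^T *m (C^T *m C) + C^T *m C *m x = 0 <->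
  (C *m x *m invmx C)^T = - (C *m x *m invmx C).
Proof.
move=> unC; have unCT : C^T \in unitmx by rewrite unitmx_tr.
have -> : (C *m x *m invmx C)^T = - (C *m x *m invmx C) <->
    invmx C^T *m (x^T *m (C^T *m C) + C^T *m C *m x) *m invmx C = 0.
  rewrite mulmxDr mulmxDl !mulmxA mulVmx // mul1mx mulmxK // !trmx_mul trmx_inv.
  rewrite mulmxA.
  by split=> [->|/eqP]; rewrite ?addNr // addr_eq0 => /eqP.
split=> [->|/(congr1 (fun M => C^T *m M *m C))]; first by rewrite mulmx0 mul0mx.
by rewrite !mulmxA mulmxV // mul1mx mulmxKV // mulmx0 mul0mx.
Qed.

Lemma mem_so (K : fieldType) n (x : 'M[K]_n) :
  x \in (so K n : {vspace _}) <-> x^T = - x.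
Proof. exact: mem_subLie_of. Qed.

Lemma conj_so_isomorphic (K : fieldType) n (S : subLie 'M[K]_n) (C : 'M[K]_n) :
  C \in unitmx ->
  (forall x, x \in (S : {vspace _}) <->
             C *m x *m invmx C \in (so K n : {vspace _})) ->
  lie_isomorphic S (so K n).
Proof.
move=> unC SE.
pose f : {linear S -> so K n} :=
  vsproj (so K n) \o (mulmxr (invmx C) \o mulmx C) \o @vsval _ _ S.
have fE (x : S) : vsval (f x) = C *m vsval x *m invmx C.
  by rewrite /= vsprojK //; apply/SE/subvsP.
exists f; split; last first.
  move=> x y; apply: val_inj; rewrite [LHS]fE [RHS]vsval_bracket !fE.
  by rewrite vsval_bracket mulmxBr mulmxBl !mulmxA !mulmxKV.
exists (fun y => vsproj S (invmx C *m vsval y *m C)) => [x|y]; apply: val_inj.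
  by rewrite fE !mulmxA mulVmx // mul1mx mulmxKV //= vsprojK // subvsP.
have h : invmx C *m vsval y *m C \in (S : {vspace _}).
  by apply/SE; rewrite !mulmxA mulmxV // mul1mx mulmxK // subvsP.
by rewrite [LHS]fE vsprojK // !mulmxA mulmxV // mul1mx mulmxK.
Qed.

(** The sizes are related by an equation because 1 + (20 - k + 1) and 22 - k, to which this is
    applied, are equal but not convertible. *)
Lemma so_form_isomorphic (K : numClosedFieldType) n n' (P : 'M[K]_n)
    (S : subLie 'M[K]_n) :
  n = n' -> P^T = P -> P \in unitmx ->
  (forall x, x \in (S : {vspace _}) <-> x^T *m P + P *m x = 0) ->
  lie_isomorphic S (so K n').
Proof.
move=> <- symP unP SE; have [C unC PE] := symmetric_congruent1 symP unP.
apply: (conj_so_isomorphic unC) => x.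
by rewrite SE PE mem_so; apply: so_conj.
Qed.

(** For x in an abelian ideal, [x, y] lies in the ideal too, so [x, [x, y]] = 0 for every y. *)
Lemma so_abelian_ideal_eq0 (K : numFieldType) n (J : {vspace so K n}) :
  n <> 2 -> is_ideal J -> lie_prod J J = 0%VS -> J = 0%VS.
Proof.
move=> n2 idJ abJ; apply/eqP; rewrite -subv0; apply/subvP => x xJ.
rewrite memv0; apply/eqP/val_inj; apply: sandwich_skew n2 _ _.
  by apply/mem_so/subvsP.
move=> y /mem_so sy.
have -> : y = vsval (vsproj (so K n) y) by rewrite vsprojK.
apply: (congr1 vsval (_ : bracket x (bracket x (vsproj (so K n) y)) = 0)).
by apply/eqP; rewrite -memv0 -abJ mem_lie_prod // ideal_meml.
Qed.

(** * Coordinates on Lie(G) and its ideals *)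

Definition restr_lfun (K : fieldType) (L : finLieAlgebraType K) (S : subLie L)
    (V : vectType K) (g : {linear L -> V}) : 'Hom(S, V) :=
  linfun (g \o @vsval _ _ S : {linear S -> V}).

Lemma restr_lfunE (K : fieldType) (L : finLieAlgebraType K) (S : subLie L)
    (V : vectType K) (g : {linear L -> V}) (x : S) :
  restr_lfun S g x = g (vsval x).
Proof. exact: (lfunE (g \o @vsval _ _ S : {linear S -> V})). Qed.

Section LieGStructure.
Variables (K : numFieldType) (m : nat) (Psi' : 'M[K]_m).
Hypothesis Psi'_sym : Psi'^T = Psi'.
Local Notation P := (Psi Psi').
Local Notation G := (LieG Psi').

Lemma trmx_Psi : P^T = P.
Proof.
by rewrite /Psi !(tr_block_mx, tr_row_mx, tr_col_mx) !(trmx0, trmx1) Psi'_sym.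
Qed.

Lemma mulPsi (a b c d : 'M[K]_1) (u t : 'rV_m) (w v : 'cV_m) (s : 'M_m) :
  P *m block_mx a (row_mx u b) (col_mx w c) (block_mx s v t d)
  = block_mx c (row_mx t d) (col_mx (Psi' *m w) a)
             (block_mx (Psi' *m s) (Psi' *m v) u b).
Proof.
rewrite /Psi mulmx_block mul_row_col mul_row_block mul_col_mx mul_col_row.
rewrite mul_block_col mulmx_block add_col_mx add_block_mx.
by rewrite !(mul0mx, mul1mx, add0r, addr0).
Qed.

(** As P is symmetric, the equation says that P x is skew-symmetric, which is read off its blocks;
    the 1 x 1 diagonal blocks of P x are c and b, which therefore vanish. *)
Lemma so_PsiP (a b c d : 'M[K]_1) (u t : 'rV_m) (w v : 'cV_m) (s : 'M_m) :
  let x := block_mx a (row_mx u b) (col_mx w c) (block_mx s v t d) in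
  x^T *m P + P *m x = 0 <->
  [/\ b = 0, c = 0, d = - a & [/\ s^T *m Psi' + Psi' *m s = 0,
      u = - (v^T *m Psi') & t = - (w^T *m Psi')]].
Proof.
have tr11 (M : 'M[K]_1) : M^T = M by apply/matrixP => i j; rewrite !ord1 mxE.
have eq2 (M : 'M[K]_1) : M + M = 0 -> M = 0.
  move/matrixP => M0; apply/matrixP => i j; have /eqP := M0 i j.
  by rewrite !mxE -mulr2n mulrn_eq0 => /eqP.
move=> x; have -> : x^T *m P = (P *m x)^T by rewrite trmx_mul trmx_Psi.
rewrite mulPsi !(tr_block_mx, tr_row_mx, tr_col_mx) !tr11 !trmx_mul Psi'_sym.
rewrite !add_block_mx add_row_mx add_col_mx.
have -> : 0 = block_mx 0 (row_mx 0 0) (col_mx 0 0) (block_mx 0 0 0 0)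
    :> 'M[K]_(1 + (m + 1)) by rewrite !(block_mx0, row_mx0, col_mx0).
split.
  move=> /eq_block_mx[/eq2-> /eq_row_mx[wt ad] _ /eq_block_mx[ss uv _ /eq2->]].
  split=> //; first by apply/eqP; rewrite -addr_eq0 addrC ad.
  split=> //; last by apply/eqP; rewrite -addr_eq0 addrC wt.
  apply: trmx_inj; apply/eqP.
  by rewrite linearN /= trmx_mul trmxK Psi'_sym -addr_eq0 uv.
move=> [-> -> -> [ss -> ->]].
by rewrite ss !linearN /= !trmx_mul !trmxK Psi'_sym !(addrN, addNr, addr0).
Qed.

Lemma mem_LieG_block (a b c d : 'M[K]_1) (u t : 'rV_m) (w v : 'cV_m)
    (s : 'M_m) :
  block_mx a (row_mx u b) (col_mx w c) (block_mx s v t d)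
    \in (G : {vspace _}) <->
  [/\ b = 0, c = 0, d = - a & [/\ s^T *m Psi' + Psi' *m s = 0,
      u = - (v^T *m Psi'), w = 0 & t = 0]].
Proof.
rewrite mem_LieG tangent_GE so_PsiP /block_lower.
rewrite !(tr_block_mx, tr_row_mx, tr_col_mx).
rewrite block_mxKur block_mxKdr block_mxKur.
split=> [[[-> -> -> [ss -> ->]] [/eqP]]|[-> -> -> [ss -> -> ->]]].
  rewrite row_mx_eq0 trmx_eq0 => /andP[/eqP-> _] _.
  by rewrite trmx0 mul0mx oppr0.
by rewrite !trmx0 mul0mx oppr0 row_mx0.
Qed.

(* The first two diagonal blocks, i.e. the actions on the graded pieces of the
   Hodge filtration; ulsubmx and drsubmx carry no linear structure in the
   library, hence the compositions. *)
Definition hodge0 : {linear 'M[K]_(1 + (m + 1)) -> 'M[K]_1} :=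
  @lsubmx K 1 1 (m + 1) \o @usubmx K 1 (m + 1) (1 + (m + 1)).
Definition hodge1 : {linear 'M[K]_(1 + (m + 1)) -> 'M[K]_m} :=
  @lsubmx K m m 1 \o @usubmx K m 1 (m + 1)
    \o (@rsubmx K (m + 1) 1 (m + 1) \o @dsubmx K 1 (m + 1) (1 + (m + 1))).

(** The general element of Lie(G) when s lies in so(Psi'): the form determines the first row and the
    last diagonal entry from a and v. *)
Definition parabolic_mx (a : 'M[K]_1) (s : 'M_m) (v : 'cV_m) :
    'M[K]_(1 + (m + 1)) :=
  block_mx a (row_mx (- (v^T *m Psi')) 0) 0 (block_mx s v 0 (- a)).

Lemma mem_LieGP x :
  x \in (G : {vspace _}) <->
  exists a s v, s^T *m Psi' + Psi' *m s = 0 /\ x = parabolic_mx a s v.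
Proof.
split=> [|[a [s [v [ss ->]]]]]; last first.
  by rewrite /parabolic_mx -[X in block_mx _ _ X]col_mx0; apply/mem_LieG_block.
rewrite -[x]submxK -[ursubmx x]hsubmxK -[dlsubmx x]vsubmxK -[drsubmx x]submxK.
move=> /mem_LieG_block[-> -> -> [ss -> -> ->]].
exists (ulsubmx x), (ulsubmx (drsubmx x)), (ursubmx (drsubmx x)).
by rewrite col_mx0.
Qed.

Lemma hodge1_parabolic a s v : hodge1 (parabolic_mx a s v) = s.
Proof.
rewrite [LHS](_ : _ = ulsubmx (drsubmx (parabolic_mx a s v))) //.
by rewrite block_mxKdr block_mxKul.
Qed.

Lemma hodge0_parabolic a s v : hodge0 (parabolic_mx a s v) = a.
Proof. exact: block_mxKul. Qed.

(** This exhibits Lie(G) as the semidirect product of K + so(Psi') with the abelian K^m, on which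
    (a, s) acts as a + s. *)
Lemma parabolic_bracket a s v a' s' v' :
  s^T *m Psi' + Psi' *m s = 0 -> s'^T *m Psi' + Psi' *m s' = 0 ->
  parabolic_mx a s v *m parabolic_mx a' s' v'
    - parabolic_mx a' s' v' *m parabolic_mx a s v
  = parabolic_mx 0 (s *m s' - s' *m s)
                   (s *m v' - v *m a' - (s' *m v - v' *m a)).
Proof.
move=> ss ss'; set p := parabolic_mx a s v; set p' := parabolic_mx a' s' v'.
(* Lie(G) being closed under the bracket, only the diagonal blocks and v have to
   be computed. *)
have : p *m p' - p' *m p \in (G : {vspace _}).
  suff : bracket p p' \in (G : {vspace _}) by [].
  by apply: (lie_prod_subP _ _ _ (subLieP G));
    apply/mem_LieGP; [exists a, s, v | exists a', s', v'].
case/mem_LieGP => a1 [s1 [v1 [_ e]]]; rewrite e; move: e.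
rewrite /p /p' /parabolic_mx !mulmx_block.
rewrite !(mul0mx, mulmx0, addr0, add0r) !opp_block_mx !add_block_mx.
move=> /eq_block_mx[a1E _ _ /eq_block_mx[<- <- _ _]].
have -> : a1 = 0.
  rewrite -a1E; apply/matrixP => i j.
  by rewrite !mxE !big_ord1 !ord1 mulrC subrr.
by rewrite !mulmxN.
Qed.

Definition LieG_hodge0 : 'Hom(G, 'M[K]_1) := restr_lfun G hodge0.
Definition LieG_hodge1 : 'Hom(G, 'M[K]_m) := restr_lfun G hodge1.
Local Notation h0 := LieG_hodge0.
Local Notation h1 := LieG_hodge1.

Lemma LieG_hodge0E x : h0 x = hodge0 (vsval x).
Proof. exact: restr_lfunE. Qed.
Lemma LieG_hodge1E x : h1 x = hodge1 (vsval x).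
Proof. exact: restr_lfunE. Qed.

Lemma LieG_parabolic (x : G) : exists a s v,
  s^T *m Psi' + Psi' *m s = 0 /\ vsval x = parabolic_mx a s v.
Proof. exact/mem_LieGP/subvsP. Qed.

Definition unipotent_radical : {vspace G} := (lker h0 :&: lker h1)%VS.
Local Notation V := unipotent_radical.

Lemma mem_unipotent (x : G) :
  x \in V <-> exists v, vsval x = parabolic_mx 0 0 v.
Proof.
rewrite memv_cap !memv_ker LieG_hodge0E LieG_hodge1E.
have [a [s [v [_ ->]]]] := LieG_parabolic x.
rewrite hodge0_parabolic hodge1_parabolic.
split=> [/andP[/eqP-> /eqP->]|[v' e]]; first by exists v.
by rewrite -(hodge0_parabolic a s v) -{2}(hodge1_parabolic a s v) e
  hodge0_parabolic hodge1_parabolic !eqxx.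
Qed.

Lemma mem_parabolic0 a v : parabolic_mx a 0 v \in (G : {vspace _}).
Proof.
by apply/mem_LieGP; exists a, 0, v; split; rewrite // trmx0 mul0mx mulmx0 addr0.
Qed.

Lemma form_skew0 : (0 : 'M[K]_m)^T *m Psi' + Psi' *m 0 = 0.
Proof. by rewrite trmx0 mul0mx mulmx0 addr0. Qed.

Lemma lie_prod_lker_hodge1 : (lie_prod (lker h1) (lker h1) <= V)%VS.
Proof.
apply/lie_prod_subP => x y; rewrite !memv_ker !LieG_hodge1E.
have [a [s [v [ss xE]]]] := LieG_parabolic x.
have [a' [s' [v' [ss' yE]]]] := LieG_parabolic y.
rewrite xE yE !hodge1_parabolic => /eqP s0 /eqP s0'.
apply/mem_unipotent; eexists; apply: etrans; first exact: vsval_bracket.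
by rewrite xE yE (parabolic_bracket _ _ _ _ ss ss') s0 s0' mulmx0 subrr.
Qed.

Lemma unipotent_abelian : lie_prod V V = 0%VS.
Proof.
apply/eqP; rewrite -subv0; apply/lie_prod_subP => x y.
move=> /mem_unipotent[v xE] /mem_unipotent[v' yE].
rewrite memv0; apply/eqP/val_inj; apply: etrans; first exact: vsval_bracket.
rewrite xE yE (parabolic_bracket _ _ _ _ form_skew0 form_skew0).
rewrite !(mul0mx, mulmx0, subr0) /parabolic_mx trmx0 mul0mx !oppr0 row_mx0.
by rewrite !block_mx0.
Qed.

Lemma unipotent_ideal : is_ideal V.
Proof.
apply/idealP => x y /mem_unipotent[v' yE].
have [a [s [v [ss xE]]]] := LieG_parabolic x.
apply/mem_unipotent; eexists; apply: etrans; first exact: vsval_bracket.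
rewrite xE yE (parabolic_bracket _ _ _ _ ss form_skew0).
by rewrite mul0mx mulmx0 subrr.
Qed.

Lemma unipotent_sub_nilradical : (V <= nilradical G)%VS.
Proof.
have [_ _ ->//] := nilradicalP G; first exact: unipotent_ideal.
by exists 1%N; apply: unipotent_abelian.
Qed.

Lemma lker_hodge1_solvable : solvable (lker h1).
Proof.
(* The first derived algebra of the kernel lies in the abelian ideal V, so the second is zero. *)
exists 2; apply/eqP; rewrite -subv0 -unipotent_abelian.
by apply: lie_prodS lie_prod_lker_hodge1 lie_prod_lker_hodge1.
Qed.

(** On the kernel s = 0, and the last column below its top entry, namely (v, - a), is a linear
    bijection onto K^(m+1). *)
Lemma dim_lker_hodge1 : \dim (lker h1) = m.+1.
Proof.
pose h := restr_lfun G
  (@rsubmx K (m + 1) m 1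
  \o (@rsubmx K (m + 1) 1 (m + 1) \o @dsubmx K 1 (m + 1) (1 + (m + 1)))).
have hE x a s v : vsval x = parabolic_mx a s v -> h x = col_mx v (- a).
  move=> xE; rewrite restr_lfunE xE.
  rewrite [LHS](_ : _ = rsubmx (drsubmx (parabolic_mx a s v))) //.
  by rewrite block_mxKdr block_mxEh row_mxKr.
have kh : (lker h1 :&: lker h = 0)%VS.
  apply/eqP; rewrite -subv0; apply/subvP => x; rewrite memv_cap !memv_ker.
  have [a [s [v [_ xE]]]] := LieG_parabolic x.
  rewrite LieG_hodge1E xE hodge1_parabolic (hE _ _ _ _ xE) col_mx_eq0 oppr_eq0.
  move=> /and3P[/eqP s0 /eqP v0 /eqP a0]; rewrite memv0; apply/eqP/val_inj.
  rewrite [LHS]xE s0 v0 a0 /parabolic_mx trmx0 mul0mx !oppr0 row_mx0.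
  by rewrite !block_mx0.
have ih : (h @: lker h1 = fullv)%VS.
  apply/eqP; rewrite eqEsubv subvf; apply/subvP => y _.
  have gp := mem_parabolic0 (- dsubmx y) (usubmx y).
  have e := vsprojK gp.
  have -> : y = h (vsproj G (parabolic_mx (- dsubmx y) 0 (usubmx y))).
    by rewrite (hE _ _ _ _ e) opprK vsubmxK.
  by rewrite memv_img // memv_ker LieG_hodge1E e hodge1_parabolic.
by rewrite -(limg_dim_eq kh) ih dimvf /dim /= muln1 addn1.
Qed.

(** * Levi quotient and radical of Lie(G) *)

Section Levi.
Variable C : 'M[K]_m.
Hypotheses (C_unit : C \in unitmx) (Psi'E : Psi' = C^T *m C).

(** Here [vsproj] only changes the type: C s C^-1 is already skew-symmetric for s in so(C^T C). *)
Definition levi_proj : 'Hom(G, so K m) :=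
  restr_lfun G (vsproj (so K m) \o (mulmxr (invmx C) \o mulmx C) \o hodge1).

Lemma levi_projE x :
  vsval (levi_proj x) = C *m hodge1 (vsval x) *m invmx C.
Proof.
have [a [s [v [ss xE]]]] := LieG_parabolic x.
rewrite restr_lfunE.
rewrite [LHS](vsprojK (_ : C *m hodge1 (vsval x) *m invmx C \in _)) //.
by rewrite xE hodge1_parabolic; apply/mem_so/so_conj; rewrite -?Psi'E.
Qed.

Lemma levi_proj_bracket x y :
  levi_proj (bracket x y) = bracket (levi_proj x) (levi_proj y).
Proof.
apply: val_inj; rewrite [LHS]levi_projE [RHS]vsval_bracket !levi_projE.
have [a [s [v [ss xE]]]] := LieG_parabolic x.
have [a' [s' [v' [ss' yE]]]] := LieG_parabolic y.
rewrite vsval_bracket xE yE (parabolic_bracket _ _ _ _ ss ss').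
rewrite !hodge1_parabolic mulmxBr mulmxBl.
by rewrite !mulmxA !mulmxKV.
Qed.

Lemma limg_levi_proj : limg levi_proj = fullv.
Proof.
apply/eqP; rewrite eqEsubv subvf; apply/subvP => y _.
have xG : parabolic_mx 0 (invmx C *m vsval y *m C) 0 \in (G : {vspace _}).
  apply/mem_LieGP; do 3!eexists; split; last by [].
  rewrite Psi'E; apply/so_conj => //.
  by rewrite !mulmxA mulmxV // mul1mx mulmxK //; apply/mem_so/subvsP.
have -> : y = levi_proj (vsproj G (parabolic_mx 0 (invmx C *m vsval y *m C) 0)).
  apply: val_inj; rewrite [RHS]levi_projE vsprojK // hodge1_parabolic.
  by rewrite !mulmxA mulmxV // mul1mx mulmxK.
by rewrite memv_img // memvf.
Qed.

Lemma lker_levi_proj : lker levi_proj = lker h1.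
Proof.
apply/vspaceP => x; rewrite !memv_ker LieG_hodge1E.
apply/eqP/eqP => [fx0|hx0]; last first.
  by apply: val_inj; rewrite [LHS]levi_projE hx0 mulmx0 mul0mx.
have := levi_projE x; rewrite fx0 => /(congr1 (fun M => invmx C *m M *m C)).
by rewrite !mulmxA mulVmx // mul1mx mulmxKV // mulmx0 mul0mx => <-.
Qed.

Lemma radical_LieG : m <> 2 -> (radical G : {vspace G}) = lker levi_proj.
Proof.
move=> m2; apply: radical_lker levi_proj_bracket limg_levi_proj _ _.
  by rewrite lker_levi_proj; apply: lker_hodge1_solvable.
by move=> J; apply: so_abelian_ideal_eq0.
Qed.

Lemma levi_isomorphic :
  m <> 2 -> lie_isomorphic (lie_quot (radical G)) (so K m).
Proof.
move=> m2; apply: (quotient_isomorphic levi_proj_bracket limg_levi_proj).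
exact: radical_LieG.
Qed.

Lemma dim_radical_LieG : m <> 2 -> \dim (radical G) = m.+1.
Proof.
by move=> m2; rewrite radical_LieG // lker_levi_proj dim_lker_hodge1.
Qed.

End Levi.

(** * The AMSY algebra as an orthogonal Lie algebra *)

(** Makes so(Psi) a bundled subalgebra, against which the minimality of the generated subalgebra can
    be tested. *)
Fact form_lie_closed n (B : 'M[K]_n) :
  lie_closed (fun x : 'M[K]_n => x^T *m B + B *m x = 0).
Proof.
split=> [|a x y ex ey|x y /eqP ex /eqP ey].
- by rewrite trmx0 mul0mx mulmx0 addr0.
- rewrite linearP /= mulmxDl mulmxDr -scalemxAl -scalemxAr addrACA -scalerDr.
  by rewrite ex ey scaler0 addr0.
rewrite !addr_eq0 in ex ey.
rewrite /bracket /= /mx_bracket linearB /= !trmx_mul mulmxBl mulmxBr -!mulmxA.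
rewrite (eqP ex) (eqP ey) !mulmxN !mulmxA (eqP ex) (eqP ey) !mulNmx !opprK.
by rewrite addrA subrK subrr.
Qed.

Lemma mulPsi_Psi : Psi' *m Psi' = 1%:M -> P *m P = 1%:M.
Proof.
move=> Psi'2; rewrite {2}/Psi mulPsi !mulmx0 Psi'2 !row_mx0 col_mx0.
by rewrite -!scalar_mx_block.
Qed.

(** Both generating sets lie in so(Psi), and conversely each element of so(Psi) is a sum of an
    element of Lie(G) and a transposed element of V. The nilradical enters only through its position
    between V and Lie(G). *)
Lemma mem_AMSY x : Psi' *m Psi' = 1%:M ->
  x \in (AMSY Psi' : {vspace _}) <-> x^T *m P + P *m x = 0.
Proof.
move=> Psi'2; have [_ genA minA] := lie_generatedP
  ([set y | y \in (G : {vspace _})] `|` nilradical_transpose Psi')%classic.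
have inG y : y \in (G : {vspace _}) -> y^T *m P + P *m y = 0.
  by move/mem_LieG/tangent_GE => [].
have P2 := mulPsi_Psi Psi'2.
split=> [|].
  rewrite -(mem_subLie_of (form_lie_closed P)); apply: subvP x.
  apply: minA; first exact: subLieP.
  move=> y [/inG yG|[z _ ->]] /=; apply/mem_subLie_of => //.
  (* Since P^2 = 1, multiplying by P on both sides turns the equation for z into the one for z^T. *)
  have /inG/(congr1 (fun M => P *m M *m P)) := subvsP z.
  rewrite mulmx0 mul0mx mulmxDr mulmxDl !mulmxA -!(mulmxA _ P P) P2.
  by rewrite mulmx1 mul1mx trmxK addrC.
rewrite -[x]submxK -[ursubmx x]hsubmxK -[dlsubmx x]vsubmxK -[drsubmx x]submxK.
set a := ulsubmx x; set v := ursubmx (drsubmx x); set s := ulsubmx (drsubmx x).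
set w := usubmx _.
move=> /so_PsiP[-> -> -> [ss -> ->]].
(* The transpose of y has - Psi' (- Psi' w) = w in the first column and - w^T Psi' in the last row,
   exactly the part of x below the block diagonal. *)
set y := vsproj G (parabolic_mx 0 0 (- (Psi' *m w))).
have yE : vsval y = parabolic_mx 0 0 (- (Psi' *m w)).
  by rewrite vsprojK // mem_parabolic0.
have yA : (vsval y)^T \in (AMSY Psi' : {vspace _}).
  apply: genA; right; exists y => //.
  apply: (subvP unipotent_sub_nilradical); apply/mem_unipotent.
  by exists (- (Psi' *m w)).
have xA : parabolic_mx a s v \in (AMSY Psi' : {vspace _}).
  by apply: genA; left; apply/mem_LieGP; exists a, s, v.
rewrite [X in X \in _](_ : _ = parabolic_mx a s v + (vsval y)^T) ?memvD //.
rewrite yE /parabolic_mx !(tr_block_mx, tr_row_mx, tr_col_mx) !add_block_mx.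
have -> : (- ((- (Psi' *m w))^T *m Psi'))^T = w.
  rewrite linearN /= trmx_mul trmxK Psi'_sym mulmxN opprK mulmxA.
  by rewrite Psi'2 mul1mx.
have -> : (- (Psi' *m w))^T = - (w^T *m Psi').
  by rewrite linearN /= trmx_mul Psi'_sym.
by rewrite oppr0 !trmx0 !addr0 !add0r.
Qed.

End LieGStructure.

(** For k = 18 one has m = 2 and so_2 is abelian, so Lie(G) is solvable of dimension 4 and equals
    its radical; hence the restriction in (1) and (2). In (4), Psi'^2 = 1 makes so(Psi) stable under
    transposition. *)
Theorem theorem4p6 (R : realType) (k : nat) (Psi' : 'M[R[i]]_(20 - k))
    (k_ge1 : (1 <= k)%N) (k_le20 : (k <= 20)%N)
    (Psi'_sym : Psi'^T = Psi') (Psi'_unit : Psi' \in unitmx) :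
  [/\ (* (1) *)
      (k <> 18)%N -> \dim (radical (LieG Psi')) = (21 - k)%N,
      (* (2) *)
      (k <> 18)%N ->
        lie_isomorphic (lie_quot (radical (LieG Psi'))) (so R[i] (20 - k)),
      (* (3) *)
      [/\ (LieG Psi' <= AMSY Psi')%VS,
          forall y : LieG Psi', y \in (nilradical (LieG Psi') : {vspace _}) ->
            (vsval y)^T \in (AMSY Psi' : {vspace _})
        & forall S : subLie 'M[R[i]]_(1 + ((20 - k) + 1)),
            (LieG Psi' <= S)%VS ->
            (forall y : LieG Psi', y \in (nilradical (LieG Psi') : {vspace _}) ->
               (vsval y)^T \in (S : {vspace _})) ->
            (AMSY Psi' <= S)%VS]
    & (* (4) *)
      Psi' *m Psi' = 1%:M -> lie_isomorphic (AMSY Psi') (so R[i] (22 - k))].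
Proof.
have [C C_unit Psi'E] := symmetric_congruent1 Psi'_sym Psi'_unit.
have [_ genA minA] := lie_generatedP ([set x | x \in (LieG Psi' : {vspace _})]
  `|` nilradical_transpose Psi')%classic.
split.
- move=> k18; rewrite (dim_radical_LieG Psi'_sym C_unit Psi'E); lia.
- move=> k18; apply: (levi_isomorphic Psi'_sym C_unit Psi'E); lia.
- split=> [|y yN|S GS NS].
  + by apply/subvP => x xG; apply: genA; left.
  + by apply: genA; right; exists y.
  + apply: minA; first exact: subLieP.
    by move=> x [xG|[y yN ->]]; [apply: subvP GS _ xG | apply: NS].
- move=> Psi'2; apply: (so_form_isomorphic (P := Psi Psi')).
  + lia.
  + exact: trmx_Psi.
  + by have [] := mulmx1_unit (mulPsi_Psi Psi'2).
  + by move=> x; apply: mem_AMSY.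
Qed.
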